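(* Assume $A_n$ satisfies (C1) and the sparseness condition $$\liminf_{n\to\infty}\frac1n\sum_{i,j=1}^nA_n(i,j)^2>0.$$ Then for every $(\beta_0,B_0)\in\Theta$, under $\mathbb P_{n,\beta_0,B_0}$, with probability tending to one the pseudo-likelihood estimator $(\hat\beta_n,\hat B_n)$ exists and $\sqrt n(\hat\beta_n-\beta_0,\hat B_n-B_0)=O_p(1)$.
   Context: For each $n$, $A_n$ is a known symmetric $n\times n$ matrix with non-negative entries and zero diagonal. The Ising model is $\mathbb P_{n,\beta,B}(\mathbf X=\mathbf x)=Z_n(\beta,B)^{-1}\exp(\frac{\beta}{2}\mathbf x^\top A_n\mathbf x+B\sum_i x_i)$ on $\{-1,1\}^n$. (C1): there is a constant $\gamma<\infty$ with $\max_{i}\sum_{j}A_n(i,j)\le\gamma$ for all $n$. $\Theta=\{(\beta,B):\beta>0,B\ne0\}$. $m_i(\mathbf x)=\sum_jA_n(i,j)x_j$. The pseudo-likelihood estimator $(\hat\beta_n,\hat B_n)$ is the unique root in $\mathbb R^2$ of $\sum_i m_i(\mathbf x)(x_i-\tanh(\beta m_i(\mathbf x)+B))=0$, $\sum_i(x_i-\tanh(\beta m_i(\mathbf x)+B))=0$, when it exists. $U_n=O_p(1)$ means tight. *)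

(* Defs.v *)
From Stdlib Require Import Reals Lra List ClassicalEpsilon.
Import ListNotations.
Open Scope R_scope.

Fixpoint rsum (n : nat) (f : nat -> R) : R :=
  match n with
  | O => 0
  | S k => rsum k f + f k
  end.

(* A weighted graph sequence: A n i j is the (i,j) entry of the n x n matrix A_n
   (only indices i, j < n are meaningful). *)
Definition Coupling := nat -> nat -> nat -> R.

Definition admissible (A : Coupling) : Prop :=
  forall n i j, (i < n)%nat -> (j < n)%nat ->
    A n i j = A n j i /\ 0 <= A n i j /\ A n i i = 0.

Definition cond_C1 (A : Coupling) : Prop :=
  exists gamma : R, forall n i, (i < n)%nat -> rsum n (fun j => A n i j) <= gamma.

(* Configurations x in {-1,1}^n encoded as lists of booleans of length n;
   true |-> +1, false |-> -1. *)
Fixpoint configs (n : nat) : list (list bool) :=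
  match n with
  | O => [[]]
  | S k => map (cons true) (configs k) ++ map (cons false) (configs k)
  end.

Definition spin (x : list bool) (i : nat) : R :=
  if nth i x false then 1 else -1.

Definition mloc (A : Coupling) (n : nat) (x : list bool) (i : nat) : R :=
  rsum n (fun j => A n i j * spin x j).

Definition ising_weight (A : Coupling) (n : nat) (beta B : R) (x : list bool) : R :=
  exp (beta / 2 * rsum n (fun i => spin x i * mloc A n x i)
       + B * rsum n (fun i => spin x i)).

Definition lsum (l : list (list bool)) (f : list bool -> R) : R :=
  fold_right (fun x acc => f x + acc) 0 l.

Definition Zpart (A : Coupling) (n : nat) (beta B : R) : R :=
  lsum (configs n) (ising_weight A n beta B).

Definition indic (P : Prop) : R :=
  if excluded_middle_informative P then 1 else 0.

Definition ising_prob (A : Coupling) (n : nat) (beta B : R)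
    (E : list bool -> Prop) : R :=
  lsum (configs n) (fun x => indic (E x) * ising_weight A n beta B x)
  / Zpart A n beta B.

Definition PL_root (A : Coupling) (n : nat) (x : list bool) (b c : R) : Prop :=
  rsum n (fun i => mloc A n x i * (spin x i - tanh (b * mloc A n x i + c))) = 0 /\
  rsum n (fun i => spin x i - tanh (b * mloc A n x i + c)) = 0.

Definition is_MPLE (A : Coupling) (n : nat) (x : list bool) (b c : R) : Prop :=
  PL_root A n x b c /\
  forall b' c', PL_root A n x b' c' -> b' = b /\ c' = c.

Definition MPLE_exists (A : Coupling) (n : nat) (x : list bool) : Prop :=
  exists b c, is_MPLE A n x b c.

Definition nonsparse (A : Coupling) : Prop :=
  exists c, 0 < c /\ exists N, forall n, (N <= n)%nat ->
    c <= / INR n * rsum n (fun i => rsum n (fun j => (A n i j) ^ 2)).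

(* Main.v *)
(* Let e_j = x_j - tanh(beta0 m_j + B0) be the residuals. Given the other spins
   e_j has mean zero, so a sum H = sum_j g_j e_j with g_j independent of x_j and
   H of bounded increments under spin flips has second moment O(n). This covers
   both pseudo-likelihood equations at (beta0, B0), as well as the sums with
   g_j = sum_i A_ij and g_j = sum_(k <> j) (A^2)_jk x_k.

   The last two give non-degeneracy: for |a| <= gamma, up to O_p(sqrt n),
     sum_i (m_i - a) sum_j A_ij e_j = sum_j (A^2)_jj x_j e_j,
   and the right-hand side is at least a constant times sum_ij A_ij^2, because
   x_j e_j = 1 - x_j tanh(.) is bounded below. As |sum_j A_ij e_j| <= 2 gamma, the
   empirical variance of the m_i is bounded below, i.e. the Hessian of the
   negative log-pseudo-likelihood is at least c n near (beta0, B0). The root is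
   then unique, and iterating gradient steps from (beta0, B0) finds it at distance
   O(|score| / n) = O_p(n^(-1/2)). *)

Require Import Defs.
From Stdlib Require Import Reals Lra Lia List Psatz ClassicalEpsilon.
From Coquelicot Require Import Coquelicot.
Import ListNotations.
Open Scope R_scope.

(** * Finite sums and spin flips *)

Lemma rsum_ext n f g :
  (forall i, (i < n)%nat -> f i = g i) -> rsum n f = rsum n g.
Proof.
  induction n as [|n IH]; intros H; simpl; [reflexivity|].
  rewrite IH by (intros; apply H; lia). now rewrite H by lia.
Qed.

Lemma rsum_plus n f g : rsum n (fun i => f i + g i) = rsum n f + rsum n g.
Proof. induction n as [|n IH]; simpl; [lra|rewrite IH; lra]. Qed.

Lemma rsum_scal n c f : rsum n (fun i => c * f i) = c * rsum n f.
Proof. induction n as [|n IH]; simpl; [lra|rewrite IH; lra]. Qed.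

Lemma rsum_minus n f g : rsum n (fun i => f i - g i) = rsum n f - rsum n g.
Proof. induction n as [|n IH]; simpl; [lra|rewrite IH; lra]. Qed.

Lemma rsum_const n c : rsum n (fun _ => c) = INR n * c.
Proof.
  induction n as [|n IH]; [simpl; lra|].
  cbn [rsum]. rewrite IH, S_INR. lra.
Qed.

Lemma rsum_le n f g :
  (forall i, (i < n)%nat -> f i <= g i) -> rsum n f <= rsum n g.
Proof.
  induction n as [|n IH]; intros H; simpl; [lra|].
  assert (rsum n f <= rsum n g) by (apply IH; intros; apply H; lia).
  assert (f n <= g n) by (apply H; lia). lra.
Qed.

Lemma rsum_bound n f c :
  (forall i, (i < n)%nat -> f i <= c) -> rsum n f <= INR n * c.
Proof. intros H. rewrite <- rsum_const. now apply rsum_le. Qed.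

Lemma rsum_nonneg n f : (forall i, (i < n)%nat -> 0 <= f i) -> 0 <= rsum n f.
Proof.
  intros H. replace 0 with (rsum n (fun _ => 0)) by (rewrite rsum_const; ring).
  now apply rsum_le.
Qed.

Lemma rsum_abs n f : Rabs (rsum n f) <= rsum n (fun i => Rabs (f i)).
Proof.
  induction n as [|n IH]; simpl; [rewrite Rabs_R0; lra|].
  eapply Rle_trans; [apply Rabs_triang|lra].
Qed.

Lemma rsum_swap n p f :
  rsum n (fun i => rsum p (fun j => f i j)) =
  rsum p (fun j => rsum n (fun i => f i j)).
Proof.
  induction n as [|n IH]; simpl.
  - symmetry. rewrite rsum_const. ring.
  - now rewrite IH, <- rsum_plus.
Qed.

Lemma rsum_update n i f g :
  (i < n)%nat -> (forall k, (k < n)%nat -> k <> i -> f k = g k) ->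
  rsum n f = rsum n g + (f i - g i).
Proof.
  induction n as [|n IH]; intros Hi H; [lia|]. simpl.
  destruct (Nat.eq_dec i n) as [->|Hn].
  - rewrite (rsum_ext n f g) by (intros; apply H; lia). ring.
  - rewrite IH by (lia || (intros; apply H; lia)).
    rewrite (H n) by lia. ring.
Qed.

Lemma rsum_single n i c :
  (i < n)%nat -> rsum n (fun j => if Nat.eqb j i then c else 0) = c.
Proof.
  intros Hi. rewrite (rsum_update n i _ (fun _ => 0) Hi).
  - rewrite rsum_const, Nat.eqb_refl. ring.
  - intros k _ Hk. apply Nat.eqb_neq in Hk. now rewrite Hk.
Qed.

Lemma rsum_cauchy_schwarz n f g :
  rsum n (fun i => f i * g i) ^ 2 <=
  rsum n (fun i => f i ^ 2) * rsum n (fun i => g i ^ 2).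
Proof.
  induction n as [|n IH]; [simpl; lra|]. cbn [rsum].
  set (p := rsum n (fun i => f i * g i)) in *.
  set (a := rsum n (fun i => f i ^ 2)) in *.
  set (b := rsum n (fun i => g i ^ 2)) in *.
  assert (Ha : 0 <= a) by (apply rsum_nonneg; intros; apply pow2_ge_0).
  assert (Hb : 0 <= b) by (apply rsum_nonneg; intros; apply pow2_ge_0).
  set (u := f n). set (v := g n).
  enough (2 * p * (u * v) <= a * v ^ 2 + u ^ 2 * b) by nra.
  assert (HX : 0 <= a * v ^ 2)
    by (apply Rmult_le_pos; [assumption|apply pow2_ge_0]).
  assert (HY : 0 <= u ^ 2 * b)
    by (apply Rmult_le_pos; [apply pow2_ge_0|assumption]).
  assert (H : p ^ 2 * (u * v) ^ 2 <= a * b * (u * v) ^ 2)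
    by (apply Rmult_le_compat_r; [apply pow2_ge_0|assumption]).
  (* The cross term is compared after squaring: [4 p^2 (u v)^2 <= 4 (a v^2) (u^2 b)], which is at
     most the square of [a v^2 + u^2 b]. *)
  apply Rsqr_incr_0_var; [|lra]. unfold Rsqr.
  pose proof (pow2_ge_0 (a * v ^ 2 - u ^ 2 * b)). nra.
Qed.

(** An index past the end leaves the list unchanged, so facts about the flipped coordinate need a
    length hypothesis. *)
Fixpoint flip (i : nat) (x : list bool) : list bool :=
  match x, i with
  | [], _ => []
  | b :: y, O => negb b :: y
  | b :: y, S k => b :: flip k y
  end.

Lemma configs_length n x : In x (configs n) -> length x = n.
Proof.
  revert x. induction n as [|n IH]; simpl; intros x H.
  - destruct H as [<-|[]]. reflexivity.
  - apply in_app_or in H.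
    destruct H as [H|H]; apply in_map_iff in H; destruct H as (y & <- & Hy);
      simpl; now rewrite IH.
Qed.

Lemma spin_flip_eq i x :
  (i < length x)%nat -> spin (flip i x) i = - spin x i.
Proof.
  unfold spin. revert i.
  induction x as [|b x IH]; intros [|i]; simpl; intros H; try lia.
  - destruct b; simpl; lra.
  - apply IH. lia.
Qed.

Lemma spin_flip_neq i k x : k <> i -> spin (flip i x) k = spin x k.
Proof.
  unfold spin. revert i k.
  induction x as [|b x IH]; intros [|i] [|k]; simpl; intros H; auto;
    contradiction.
Qed.

Lemma spin_sqr x i : spin x i * spin x i = 1.
Proof. unfold spin. destruct (nth i x false); ring. Qed.

Lemma spin_abs x i : Rabs (spin x i) = 1.
Proof.
  unfold spin. destruct (nth i x false); unfold Rabs; destruct Rcase_abs; lra.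
Qed.

Lemma lsum_app l l' f : lsum (l ++ l') f = lsum l f + lsum l' f.
Proof.
  unfold lsum. induction l as [|x l IH]; simpl; [lra|rewrite IH; lra].
Qed.

Lemma lsum_map g l f : lsum (map g l) f = lsum l (fun x => f (g x)).
Proof. unfold lsum. induction l as [|x l IH]; simpl; [lra|now rewrite IH]. Qed.

Lemma lsum_ext l f g : (forall x, In x l -> f x = g x) -> lsum l f = lsum l g.
Proof.
  unfold lsum. induction l as [|x l IH]; simpl; intros H; [easy|].
  rewrite H, IH; auto.
Qed.

Lemma lsum_le l f g : (forall x, In x l -> f x <= g x) -> lsum l f <= lsum l g.
Proof.
  unfold lsum. induction l as [|x l IH]; simpl; intros H; [lra|].
  apply Rplus_le_compat; auto.
Qed.

Lemma lsum_plus l f g : lsum l (fun x => f x + g x) = lsum l f + lsum l g.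
Proof. unfold lsum. induction l as [|x l IH]; simpl; [lra|rewrite IH; lra]. Qed.

Lemma lsum_scal l c f : lsum l (fun x => c * f x) = c * lsum l f.
Proof. unfold lsum. induction l as [|x l IH]; simpl; [lra|rewrite IH; lra]. Qed.

Lemma lsum_rsum l n f :
  lsum l (fun x => rsum n (f x)) = rsum n (fun i => lsum l (fun x => f x i)).
Proof.
  unfold lsum. induction l as [|x l IH]; simpl.
  - rewrite rsum_const. ring.
  - now rewrite IH, rsum_plus.
Qed.

(** Flipping one coordinate permutes the configurations; this is the change of variables behind the
    cancellation of residuals. *)
Lemma lsum_configs_flip n i f :
  (i < n)%nat -> lsum (configs n) (fun x => f (flip i x)) = lsum (configs n) f.
Proof.
  revert i f. induction n as [|n IH]; intros i f Hi; [lia|]. simpl.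
  rewrite !lsum_app, !lsum_map. destruct i as [|i]; simpl.
  (* Flipping the head spin exchanges the two halves of [configs]. *)
  - apply Rplus_comm.
  - rewrite (IH i (fun y => f (true :: y))) by lia.
    now rewrite (IH i (fun y => f (false :: y))) by lia.
Qed.

Lemma rsum_spin_flip n i a x :
  (i < n)%nat -> length x = n ->
  rsum n (fun j => a j * spin (flip i x) j) =
  rsum n (fun j => a j * spin x j) - 2 * (a i * spin x i).
Proof.
  intros Hi Hx.
  rewrite (rsum_update n i _ (fun j => a j * spin x j) Hi).
  - rewrite spin_flip_eq by lia. ring.
  - intros k _ Hk. now rewrite spin_flip_neq.
Qed.

(** * The hyperbolic tangent *)

Lemma cosh_ge_1 u : 1 <= cosh u.
Proof.
  unfold cosh. rewrite exp_Ropp. pose proof (exp_pos u) as H.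
  enough (0 <= (exp u - 1) ^ 2 * / exp u).
  { replace ((exp u - 1) ^ 2 * / exp u) with (exp u + / exp u - 2) in *
      by (field; lra). lra. }
  apply Rmult_le_pos; [apply pow2_ge_0|].
  now apply Rlt_le, Rinv_0_lt_compat.
Qed.

Lemma cosh_le_exp u U : Rabs u <= U -> cosh u <= exp U.
Proof.
  intros H. apply Rabs_le_between in H. unfold cosh.
  assert (forall v, v <= U -> exp v <= exp U) as He.
  { intros v [Hv| ->]; [left; now apply exp_increasing|lra]. }
  pose proof (He u ltac:(lra)). pose proof (He (- u) ltac:(lra)). lra.
Qed.

Lemma tanh_derive u : is_derive tanh u (/ cosh u ^ 2).
Proof.
  pose proof (cosh_ge_1 u).
  apply is_derive_ext with (fun t => sinh t / cosh t); [reflexivity|].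
  assert (Hs : is_derive sinh u (cosh u))
    by (apply is_derive_Reals, derivable_pt_lim_sinh).
  assert (Hc : is_derive cosh u (sinh u))
    by (apply is_derive_Reals, derivable_pt_lim_cosh).
  evar_last; [apply (is_derive_div _ _ _ _ _ Hs Hc); lra|].
  assert (E : cosh u * cosh u - sinh u * sinh u = 1).
  { unfold cosh, sinh. rewrite exp_Ropp. field. apply Rgt_not_eq, exp_pos. }
  replace (cosh u * cosh u - sinh u * sinh u) with 1 by (symmetry; exact E).
  unfold Rdiv. ring.
Qed.

(** By the mean value theorem [t] is [1 / cosh^2] at a point between [u] and [v], where
    [1 <= cosh <= exp U]. *)
Lemma tanh_mvt u v U :
  Rabs u <= U -> Rabs v <= U ->
  exists t, exp (- (2 * U)) <= t <= 1 /\ tanh u - tanh v = t * (u - v).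
Proof.
  intros Hu Hv.
  destruct (MVT_gen tanh v u (fun u => / cosh u ^ 2)) as (w & Hw & E).
  - intros; apply tanh_derive.
  - intros y _. apply continuity_pt_filterlim.
    apply (ex_derive_continuous tanh). eexists; apply tanh_derive.
  - exists (/ cosh w ^ 2). split; [|exact E].
    assert (Hw' : Rabs w <= U).
    { apply Rabs_le_between in Hu. apply Rabs_le_between in Hv.
      apply Rabs_le. unfold Rmin, Rmax in Hw. destruct (Rle_dec v u); lra. }
    pose proof (cosh_ge_1 w). pose proof (cosh_le_exp w U Hw').
    split.
    + rewrite exp_Ropp.
      replace (exp (2 * U)) with (exp U ^ 2)
        by (simpl; rewrite Rmult_1_r, <- exp_plus; f_equal; ring).
      apply Rinv_le_contravar; nra.
    + rewrite <- Rinv_1. apply Rinv_le_contravar; nra.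
Qed.

Lemma tanh_lipschitz u v : Rabs (tanh u - tanh v) <= Rabs (u - v).
Proof.
  destruct (tanh_mvt u v (Rmax (Rabs u) (Rabs v))) as (t & Ht & ->);
    [apply Rmax_l|apply Rmax_r|].
  pose proof (exp_pos (- (2 * Rmax (Rabs u) (Rabs v)))).
  rewrite Rabs_mult, (Rabs_right t) by lra.
  pose proof (Rabs_pos (u - v)). nra.
Qed.

(** With [t] the slope of the chord, the bounds say [exp (- (2 * U)) <= t] and [t^2 <= t]. They
    later yield strong monotonicity and co-coercivity of minus the score. *)
Lemma tanh_monotone u v U :
  Rabs u <= U -> Rabs v <= U ->
  exp (- (2 * U)) * (u - v) ^ 2 <= (u - v) * (tanh u - tanh v) /\
  (tanh u - tanh v) ^ 2 <= (u - v) * (tanh u - tanh v).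
Proof.
  intros Hu Hv. destruct (tanh_mvt u v U Hu Hv) as (t & Ht & ->).
  pose proof (exp_pos (- (2 * U))). pose proof (pow2_ge_0 (u - v)) as Hd.
  split; [nra|].
  assert (0 <= t * (1 - t) * (u - v) ^ 2)
    by (apply Rmult_le_pos; [apply Rmult_le_pos; lra|exact Hd]).
  nra.
Qed.

(** [1 - tanh u = exp (- u) / cosh u], and both factors [exp (- u)] and [1 / cosh u] are at least
    [exp (- U)]. *)
Lemma one_minus_tanh_lower u U :
  Rabs u <= U -> exp (- (2 * U)) <= 1 - tanh u.
Proof.
  intros H. apply Rabs_le_between in H.
  pose proof (exp_pos u). pose proof (exp_pos (- u)).
  replace (1 - tanh u) with (exp (- u) * (2 / (exp u + exp (- u))))
    by (unfold tanh, sinh, cosh; field; lra).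
  assert (Hi : exp (- U) <= exp (- u)).
  { destruct (Req_dec u U) as [->|]; [lra|]. left; apply exp_increasing; lra. }
  assert (Hd : exp (- U) <= 2 / (exp u + exp (- u))).
  { pose proof (cosh_le_exp u U ltac:(apply Rabs_le; lra)) as Hc.
    pose proof (cosh_ge_1 u).
    replace (2 / (exp u + exp (- u))) with (/ cosh u)
      by (unfold cosh; field; lra).
    rewrite exp_Ropp. apply Rinv_le_contravar; lra. }
  replace (- (2 * U)) with (- U + - U) by ring. rewrite exp_plus.
  pose proof (exp_pos (- U)). apply Rmult_le_compat; lra.
Qed.

Lemma tanh_opp u : tanh (- u) = - tanh u.
Proof.
  unfold tanh, sinh, cosh. rewrite Ropp_involutive.
  pose proof (exp_pos u). pose proof (exp_pos (- u)). field. lra.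
Qed.

Lemma tanh_abs_le_1 u : Rabs (tanh u) <= 1.
Proof.
  pose proof (one_minus_tanh_lower u (Rabs u) (Rle_refl _)).
  pose proof (one_minus_tanh_lower (- u) (Rabs u)) as H1.
  rewrite Rabs_Ropp, tanh_opp in H1. specialize (H1 (Rle_refl _)).
  pose proof (exp_pos (- (2 * Rabs u))). apply Rabs_le. lra.
Qed.

(** * A contraction principle on balls *)

(** Banach iteration for a map known to contract only on a ball: the bound on the first step keeps
    every iterate inside, since [q r + (1 - q) r = r]. *)
Lemma contraction_fixed_point {V : CompleteNormedModule R_AbsRing}
    (f : V -> V) (x0 : V) (r q : R) :
  0 <= r -> 0 <= q < 1 ->
  (forall x y : V, norm (minus x x0) <= r -> norm (minus y x0) <= r ->
     norm (minus (f x) (f y)) <= q * norm (minus x y)) ->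
  norm (minus (f x0) x0) <= (1 - q) * r ->
  exists x, norm (minus x x0) <= r /\ f x = x.
Proof.
  set (d (x y : V) := norm (minus x y)).
  intros Hr Hq Hf Hx0.
  change (forall x y : V, d x x0 <= r -> d y x0 <= r ->
            d (f x) (f y) <= q * d x y) in Hf.
  change (d (f x0) x0 <= (1 - q) * r) in Hx0.
  change (exists x : V, d x x0 <= r /\ f x = x).
  assert (Hpos : forall x y, 0 <= d x y) by (intros; apply norm_ge_0).
  assert (Hsym : forall x y, d x y = d y x).
  { intros x y. unfold d. rewrite <- (opp_minus y x).
    exact (@norm_opp _ V _). }
  assert (Htri : forall x y z, d x z <= d x y + d y z).
  { intros x y z. unfold d. rewrite (minus_trans y x z).
    exact (@norm_triangle _ V _ _). }
  assert (N0 : d x0 x0 = 0).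
  { rewrite <- (@norm_zero _ V). unfold d. f_equal. apply (plus_opp_r x0). }
  set (s k := Nat.iter k f x0).
  assert (Hs : forall k, s (S k) = f (s k)) by reflexivity.
  assert (Hball : forall k, d (s k) x0 <= r).
  { induction k as [|k IH]; [change (d x0 x0 <= r); lra|].
    rewrite Hs. pose proof (Htri (f (s k)) (f x0) x0).
    pose proof (Hf (s k) x0 IH ltac:(lra)). nra. }
  set (a k := minus (s (S k)) (s k)).
  assert (Ha : forall k, norm (a k) <= q ^ k * norm (a O)).
  { induction k as [|k IH]; [simpl; lra|].
    apply Rle_trans with (q * norm (a k)).
    - apply (Hf (s (S k)) (s k)); apply Hball.
    - simpl. rewrite Rmult_assoc. apply Rmult_le_compat_l; lra. }
  destruct (ex_series_le a (fun k => q ^ k * norm (a O)) Ha) as [l Hl].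
  { apply ex_series_scal_r, ex_series_geom. rewrite Rabs_right; lra. }
  assert (Hsum : forall k, sum_n a k = minus (s (S k)) x0).
  { induction k as [|k IH]; [now rewrite sum_O|].
    rewrite sum_Sn, IH, plus_comm. symmetry. apply minus_trans. }
  set (z := plus l x0 : V).
  assert (E : forall k, minus (sum_n a k) l = minus (s (S k)) z).
  { intros k. rewrite Hsum. unfold minus, z.
    etransitivity; [symmetry; exact (@plus_assoc V _ _ _)|].
    apply f_equal. etransitivity; [exact (@plus_comm V _ _)|].
    symmetry. exact (@opp_plus V l x0). }
  (* Here [y] is an iterate and [f y] the next one; their closeness to [z] carries the ball bound
     and the fixed point equation to the limit. *)
  assert (Hlim : forall eps, 0 < eps -> exists y,
    d y x0 <= r /\ d y z <= eps /\ d (f y) z <= eps).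
  { intros eps He.
    destruct (proj1 (filterlim_locally_ball_norm (sum_n a) l) Hl
                (mkposreal eps He)) as [N HN].
    exists (s (S N)). split; [apply Hball|].
    pose proof (HN N ltac:(lia)) as H1. pose proof (HN (S N) ltac:(lia)) as H2.
    unfold ball_norm in H1, H2. rewrite E in H1, H2.
    split; [now left|left; exact H2]. }
  assert (Hz : d z x0 <= r).
  { apply le_epsilon. intros eps He.
    destruct (Hlim eps He) as (y & Hy & Hyz & _).
    pose proof (Htri z y x0). pose proof (Hsym y z). lra. }
  exists z. split; [exact Hz|].
  assert (H0 : d (f z) z = 0).
  { apply Rle_antisym; [|apply Hpos].
    apply le_epsilon. intros eps He.
    destruct (Hlim (eps / 2) ltac:(lra)) as (y & Hy & Hyz & Hfy).
    pose proof (Htri (f z) (f y) z).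
    pose proof (Hf z y Hz Hy) as H1. rewrite (Hsym z y) in H1.
    pose proof (Hpos y z). nra. }
  apply norm_eq_zero in H0.
  transitivity (plus (minus (f z) z) z : V).
  - unfold minus. etransitivity; [symmetry; exact (@plus_zero_r V (f z))|].
    etransitivity; [|exact (@plus_assoc V _ _ _)].
    apply f_equal. symmetry. exact (@plus_opp_l V z).
  - etransitivity; [|exact (@plus_zero_l V z)].
    exact (f_equal (fun w : V => plus w z) H0).
Qed.

(** The complex numbers serve as the complete Euclidean plane. This norm is the one suited to the
    inner product estimate for a gradient step, and squared distances keep square roots out of the
    hypotheses. *)
Lemma contraction_fixed_point_plane (f g : R -> R -> R) (b0 c0 r s : R) :
  0 <= r -> 0 < s <= 1 ->
  (forall b c b' c', 
     (b - b0) ^ 2 + (c - c0) ^ 2 <= r ^ 2 ->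
     (b' - b0) ^ 2 + (c' - c0) ^ 2 <= r ^ 2 ->
     (f b c - f b' c') ^ 2 + (g b c - g b' c') ^ 2 <=
     (1 - s) ^ 2 * ((b - b') ^ 2 + (c - c') ^ 2)) ->
  (f b0 c0 - b0) ^ 2 + (g b0 c0 - c0) ^ 2 <= (s * r) ^ 2 ->
  exists b c, (b - b0) ^ 2 + (c - c0) ^ 2 <= r ^ 2 /\ f b c = b /\ g b c = c.
Proof.
  intros Hr Hs Hfg H0.
  assert (HC : forall (x y : C_R_CompleteNormedModule) t, 0 <= t ->
    norm (minus x y) <= t <->
    (fst x - fst y) ^ 2 + (snd x - snd y) ^ 2 <= t ^ 2).
  { intros x y t Ht.
    change (norm (minus x y)) with
      (sqrt (Rabs (fst x - fst y) ^ 2 + Rabs (snd x - snd y) ^ 2)).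
    rewrite !pow2_abs.
    pose proof (pow2_ge_0 (fst x - fst y)).
    pose proof (pow2_ge_0 (snd x - snd y)).
    assert (P : 0 <= (fst x - fst y) ^ 2 + (snd x - snd y) ^ 2) by lra.
    split; intros Hle.
    - rewrite <- (pow2_sqrt _ P). apply pow_incr. split; [apply sqrt_pos|easy].
    - rewrite <- (sqrt_pow2 t Ht). now apply sqrt_le_1_alt. }
  destruct (@contraction_fixed_point C_R_CompleteNormedModule
    (fun z => (f (fst z) (snd z), g (fst z) (snd z))) (b0, c0) r (1 - s))
    as ([b c] & Hb & E).
  - exact Hr.
  - lra.
  - intros x y Hx Hy.
    pose proof (norm_ge_0 (minus x y)).
    apply (proj1 (HC x (b0, c0) r Hr)) in Hx.
    apply (proj1 (HC y (b0, c0) r Hr)) in Hy.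
    apply HC; [apply Rmult_le_pos; lra|]. simpl fst. simpl snd.
    eapply Rle_trans; [apply Hfg; assumption|].
    rewrite Rpow_mult_distr. apply Rmult_le_compat_l; [apply pow2_ge_0|].
    apply HC; [assumption|]. apply Rle_refl.
  - apply HC; [apply Rmult_le_pos; lra|]. simpl fst; simpl snd.
    now replace (1 - (1 - s)) with s by ring.
  - exists b, c. apply (proj1 (HC (b, c) (b0, c0) r Hr)) in Hb.
    injection E as E1 E2. auto.
Qed.

(** * The pseudo-likelihood equations *)

(** The partial derivatives of the log-pseudo-likelihood in [b] and, for [score2], in [c]. Fields
    and spins are arbitrary reals here: only the convex analysis matters in this part. *)
Definition score1 n (m x : nat -> R) b c :=
  rsum n (fun i => m i * (x i - tanh (b * m i + c))).

Definition score2 n (m x : nat -> R) b c :=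
  rsum n (fun i => x i - tanh (b * m i + c)).

(** Since [a] is the mean of the [m i], writing [p m_i + q = p (m_i - a) + (p a + q)] kills the
    cross term. A variance bound on the fields thus becomes a bound on the least eigenvalue of the
    Gram matrix of [m] and the constant vector. *)
Lemma quadratic_form_lower n m a gamma delta lam p q :
  INR n * a = rsum n m -> Rabs a <= gamma ->
  INR n * delta <= rsum n (fun i => (m i - a) ^ 2) ->
  0 <= lam -> lam * (1 + 2 * gamma ^ 2) <= delta -> 2 * lam <= 1 ->
  INR n * (lam * (p ^ 2 + q ^ 2)) <= rsum n (fun i => (p * m i + q) ^ 2).
Proof.
  intros Ha Hg Hd Hl0 Hl Hl2.
  assert (E : rsum n (fun i => (p * m i + q) ^ 2) =
    p ^ 2 * rsum n (fun i => (m i - a) ^ 2) + INR n * (p * a + q) ^ 2).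
  { rewrite (rsum_ext n _ (fun i => p ^ 2 * (m i - a) ^ 2 +
      (2 * p * (p * a + q) * (m i - a) + (p * a + q) ^ 2)))
      by (intros; ring).
    rewrite !rsum_plus, !rsum_scal, rsum_const, rsum_minus, rsum_const, <- Ha.
    ring. }
  rewrite E.
  pose proof (pos_INR n) as Hn. pose proof (pow2_ge_0 p) as Hp.
  assert (H1 : p ^ 2 * (INR n * delta) <=
    p ^ 2 * rsum n (fun i => (m i - a) ^ 2)) by now apply Rmult_le_compat_l.
  enough (H2 : lam * (p ^ 2 + q ^ 2) <= p ^ 2 * delta + (p * a + q) ^ 2).
  { apply (Rmult_le_compat_l _ _ _ Hn) in H2. lra. }
  (* From [q = (p a + q) - p a]; the two conditions on [lam] then absorb the resulting coefficients
     of [p^2] and [(p a + q)^2]. *)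
  assert (H3 : q ^ 2 <= 2 * (p * a + q) ^ 2 + 2 * (p ^ 2 * gamma ^ 2)).
  { assert (a ^ 2 <= gamma ^ 2)
      by (rewrite <- (pow2_abs a); apply pow_incr; split; [apply Rabs_pos|easy]).
    assert (p ^ 2 * a ^ 2 <= p ^ 2 * gamma ^ 2) by now apply Rmult_le_compat_l.
    pose proof (pow2_ge_0 (2 * (p * a) + q)). nra. }
  apply (Rmult_le_compat_l lam) in H3; [|easy].
  apply (Rmult_le_compat_l (p ^ 2)) in Hl; [|easy].
  pose proof (pow2_ge_0 (p * a + q)). nra.
Qed.

Lemma linear_abs_le b c m gamma :
  Rabs m <= gamma -> Rabs (b * m + c) <= Rabs b * gamma + Rabs c.
Proof.
  intros H. eapply Rle_trans; [apply Rabs_triang|]. rewrite Rabs_mult.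
  pose proof (Rabs_pos b). nra.
Qed.

(** [Y] equals the sum of [(u i - v i) * (tanh (u i) - tanh (v i))]. The slope lower bound gives
    strong monotonicity; the slope upper bound with Cauchy-Schwarz gives co-coercivity. *)
Lemma score_monotone n m x gamma lam U b c b' c' :
  (forall i, (i < n)%nat -> Rabs (m i) <= gamma) ->
  (forall p q, INR n * (lam * (p ^ 2 + q ^ 2)) <=
     rsum n (fun i => (p * m i + q) ^ 2)) ->
  Rabs b * gamma + Rabs c <= U -> Rabs b' * gamma + Rabs c' <= U ->
  let D1 := score1 n m x b c - score1 n m x b' c' in
  let D2 := score2 n m x b c - score2 n m x b' c' in
  let Y := - ((b - b') * D1 + (c - c') * D2) in
  exp (- (2 * U)) * (INR n * (lam * ((b - b') ^ 2 + (c - c') ^ 2))) <= Y /\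
  D1 ^ 2 + D2 ^ 2 <= INR n * (gamma ^ 2 + 1) * Y.
Proof.
  intros Hm Hlam HU HU' D1 D2 Y.
  set (u i := b * m i + c). set (v i := b' * m i + c').
  set (t i := tanh (u i) - tanh (v i)).
  assert (Hu : forall i, (i < n)%nat -> Rabs (u i) <= U).
  { intros i Hi. eapply Rle_trans; [apply (linear_abs_le _ _ _ gamma)|]; auto. }
  assert (Hv : forall i, (i < n)%nat -> Rabs (v i) <= U).
  { intros i Hi. eapply Rle_trans; [apply (linear_abs_le _ _ _ gamma)|]; auto. }
  assert (E1 : D1 = - rsum n (fun i => m i * t i)).
  { unfold D1, score1. rewrite <- rsum_minus.
    replace (- rsum n (fun i => m i * t i)) with
      ((-1) * rsum n (fun i => m i * t i)) by ring.
    rewrite <- rsum_scal. apply rsum_ext. intros; unfold t, u, v; ring. }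
  assert (E2 : D2 = - rsum n t).
  { unfold D2, score2. rewrite <- rsum_minus.
    replace (- rsum n t) with ((-1) * rsum n t) by ring.
    rewrite <- rsum_scal. apply rsum_ext. intros; unfold t, u, v; ring. }
  assert (EY : Y = rsum n (fun i => (u i - v i) * t i)).
  { unfold Y. rewrite E1, E2.
    transitivity ((b - b') * rsum n (fun i => m i * t i) + (c - c') * rsum n t);
      [ring|].
    rewrite <- !rsum_scal, <- rsum_plus. apply rsum_ext.
    intros; unfold u, v; ring. }
  split.
  - eapply Rle_trans.
    { apply Rmult_le_compat_l; [apply Rlt_le, exp_pos|apply Hlam]. }
    rewrite <- rsum_scal, EY. apply rsum_le. intros i Hi.
    destruct (tanh_monotone (u i) (v i) U (Hu i Hi) (Hv i Hi)) as [H _].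
    replace ((b - b') * m i + (c - c')) with (u i - v i) by (unfold u, v; ring).
    exact H.
  - assert (HY : rsum n (fun i => t i ^ 2) <= Y).
    { rewrite EY. apply rsum_le. intros i Hi.
      now apply (tanh_monotone (u i) (v i) U); auto. }
    assert (Ht : 0 <= rsum n (fun i => t i ^ 2))
      by (apply rsum_nonneg; intros; apply pow2_ge_0).
    pose proof (pos_INR n) as Hn.
    assert (C1 : D1 ^ 2 <= INR n * gamma ^ 2 * rsum n (fun i => t i ^ 2)).
    { rewrite E1. replace ((- rsum n (fun i => m i * t i)) ^ 2) with
        (rsum n (fun i => m i * t i) ^ 2) by ring.
      eapply Rle_trans; [apply rsum_cauchy_schwarz|].
      apply Rmult_le_compat_r; [easy|]. apply rsum_bound. intros i Hi.
      rewrite <- pow2_abs. apply pow_incr. split; [apply Rabs_pos|auto]. }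
    assert (C2 : D2 ^ 2 <= INR n * rsum n (fun i => t i ^ 2)).
    { rewrite E2. replace ((- rsum n t) ^ 2) with
        (rsum n (fun i => 1 * t i) ^ 2)
        by (rewrite rsum_scal; ring).
      eapply Rle_trans; [apply (rsum_cauchy_schwarz n (fun _ => 1))|].
      rewrite (rsum_const n (1 ^ 2)). right; ring. }
    assert (0 <= gamma ^ 2) by apply pow2_ge_0.
    apply Rle_trans with
      (INR n * (gamma ^ 2 + 1) * rsum n (fun i => t i ^ 2)); [lra|].
    apply Rmult_le_compat_l; [|easy]. apply Rmult_le_pos; lra.
Qed.

(** At two roots the score differences vanish, so strong monotonicity forces distance zero. Taking
    [U] as a maximum over the two points makes uniqueness global. *)
Lemma score_root_unique n m x gamma lam b c b' c' :
  (0 < n)%nat -> 0 < lam ->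
  (forall i, (i < n)%nat -> Rabs (m i) <= gamma) ->
  (forall p q, INR n * (lam * (p ^ 2 + q ^ 2)) <=
     rsum n (fun i => (p * m i + q) ^ 2)) ->
  score1 n m x b c = 0 /\ score2 n m x b c = 0 ->
  score1 n m x b' c' = 0 /\ score2 n m x b' c' = 0 ->
  b' = b /\ c' = c.
Proof.
  intros Hn Hl Hm Hlam [R1 R2] [R1' R2'].
  destruct (score_monotone n m x gamma lam
    (Rmax (Rabs b * gamma + Rabs c) (Rabs b' * gamma + Rabs c')) b c b' c'
    Hm Hlam (Rmax_l _ _) (Rmax_r _ _)) as [H _].
  rewrite R1, R2, R1', R2' in H.
  apply lt_0_INR in Hn.
  set (k := exp _) in H. assert (Hk : 0 < k) by apply exp_pos.
  set (w := (b - b') ^ 2 + (c - c') ^ 2) in H.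
  assert (Hw : w <= 0).
  { assert (0 < k * INR n * lam)
      by (apply Rmult_lt_0_compat; [apply Rmult_lt_0_compat|]; easy).
    apply Rmult_le_reg_l with (k * INR n * lam); [easy|]. lra. }
  unfold w in Hw. pose proof (pow2_ge_0 (b - b')). pose proof (pow2_ge_0 (c - c')).
  split; nra.
Qed.

(** [U] bounds the arguments of [tanh] on the unit ball around [(b0, c0)], whence the requirement
    [r <= 1]. The radius is such that the first gradient step fits the contraction principle. *)
Lemma score_root_exists n m x gamma lam K b0 c0 :
  let U := (Rabs b0 + 1) * gamma + Rabs c0 + 1 in
  let r := 2 * sqrt (K / INR n) / (exp (- (2 * U)) * lam) in
  (0 < n)%nat -> 0 < lam <= 1 -> 0 <= gamma -> 0 <= K ->
  (forall i, (i < n)%nat -> Rabs (m i) <= gamma) ->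
  (forall p q, INR n * (lam * (p ^ 2 + q ^ 2)) <=
     rsum n (fun i => (p * m i + q) ^ 2)) ->
  score1 n m x b0 c0 ^ 2 + score2 n m x b0 c0 ^ 2 <= K * INR n ->
  r <= 1 ->
  exists b c, (score1 n m x b c = 0 /\ score2 n m x b c = 0) /\
    (b - b0) ^ 2 + (c - c0) ^ 2 <= r ^ 2.
Proof.
  intros U r Hn Hl Hg HK Hm Hlam H0 Hr1.
  assert (Hn' : 0 < INR n) by now apply lt_0_INR.
  assert (HU : 0 <= U).
  { unfold U. pose proof (Rabs_pos b0). pose proof (Rabs_pos c0). nra. }
  set (k := exp (- (2 * U))) in *.
  assert (Hk : 0 < k <= 1).
  { split; [apply exp_pos|]. unfold k. rewrite <- exp_0.
    destruct HU as [HU| <-]; [left; apply exp_increasing; lra|].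
    right; f_equal; ring. }
  assert (Hkl : 0 < k * lam <= 1) by nra.
  assert (Hr : 0 <= r).
  { unfold r. apply Rmult_le_pos; [|now apply Rlt_le, Rinv_0_lt_compat].
    pose proof (sqrt_pos (K / INR n)). lra. }
  set (L := gamma ^ 2 + 1).
  assert (HL : 1 <= L) by (unfold L; pose proof (pow2_ge_0 gamma); lra).
  set (e := / (INR n * L)).
  assert (HnL : 0 < INR n * L) by (apply Rmult_lt_0_compat; lra).
  assert (He : 0 < e) by now apply Rinv_0_lt_compat.
  assert (Hbox : forall b c, (b - b0) ^ 2 + (c - c0) ^ 2 <= r ^ 2 ->
    Rabs b * gamma + Rabs c <= U).
  { intros b c H.
    assert (Hp : r ^ 2 <= 1) by nra.
    assert (Hb : Rabs (b - b0) <= 1).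
    { apply Rabs_le. pose proof (pow2_ge_0 (c - c0)). nra. }
    assert (Hc : Rabs (c - c0) <= 1).
    { apply Rabs_le. pose proof (pow2_ge_0 (b - b0)). nra. }
    pose proof (Rabs_triang b0 (b - b0)) as Tb.
    pose proof (Rabs_triang c0 (c - c0)) as Tc.
    replace (b0 + (b - b0)) with b in Tb by ring.
    replace (c0 + (c - c0)) with c in Tc by ring.
    unfold U. assert (Rabs b * gamma <= (Rabs b0 + 1) * gamma)
      by (apply Rmult_le_compat_r; lra). lra. }
  set (s := k * lam / (2 * L)).
  assert (Hs : 2 * s * L = k * lam) by (unfold s; field; lra).
  assert (Hs' : 0 < s <= 1) by (split; nra).
  (* The score is minus a gradient of a convex function, so a gradient step of
     size [1 / (n L)] contracts by [1 - s] where the Hessian exceeds [k lam n]. *)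
  destruct (contraction_fixed_point_plane
    (fun b c => b + e * score1 n m x b c) (fun b c => c + e * score2 n m x b c)
    b0 c0 r s) as (b & c & Hb & E1 & E2).
  - exact Hr.
  - exact Hs'.
  - intros b c b' c' Hb Hb'.
    destruct (score_monotone n m x gamma lam U b c b' c' Hm Hlam
      (Hbox _ _ Hb) (Hbox _ _ Hb')) as [HY HD].
    fold k in HY. fold L in HD.
    set (D1 := score1 n m x b c - score1 n m x b' c') in *.
    set (D2 := score2 n m x b c - score2 n m x b' c') in *.
    set (Y := - ((b - b') * D1 + (c - c') * D2)) in *.
    set (w := (b - b') ^ 2 + (c - c') ^ 2) in *.
    assert (Hw : 0 <= w).
    { unfold w. pose proof (pow2_ge_0 (b - b')).
      pose proof (pow2_ge_0 (c - c')). lra. }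
    replace ((b + e * score1 n m x b c - (b' + e * score1 n m x b' c')) ^ 2 +
             (c + e * score2 n m x b c - (c' + e * score2 n m x b' c')) ^ 2)
      with (w - 2 * e * Y + e * (e * (D1 ^ 2 + D2 ^ 2)))
      by (unfold w, Y, D1, D2; ring).
    (* Co-coercivity uses up one of the two copies of [e * Y]; strong monotonicity turns the other
       into [2 s w], and [1 - 2 s <= (1 - s)^2]. *)
    assert (HeD : e * (D1 ^ 2 + D2 ^ 2) <= Y).
    { replace Y with (e * (INR n * L * Y)) by (unfold e; field; lra).
      apply Rmult_le_compat_l; lra. }
    assert (HeY : 2 * s * w <= e * Y).
    { replace (2 * s * w) with (e * (k * (INR n * (lam * w))))
        by (unfold e, s; field; lra).
      apply Rmult_le_compat_l; lra. }
    apply (Rmult_le_compat_l e) in HeD; [|lra].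
    assert (0 <= s ^ 2 * w) by (apply Rmult_le_pos; [apply pow2_ge_0|easy]).
    lra.
  - replace ((b0 + e * score1 n m x b0 c0 - b0) ^ 2 +
             (c0 + e * score2 n m x b0 c0 - c0) ^ 2) with
      (e ^ 2 * (score1 n m x b0 c0 ^ 2 + score2 n m x b0 c0 ^ 2)) by ring.
    apply Rle_trans with (e ^ 2 * (K * INR n)).
    { apply Rmult_le_compat_l; [apply pow2_ge_0|easy]. }
    (* The first step has length at most [e * sqrt (K * INR n) = sqrt (K / INR n) / L], which is
       exactly [s * r]. *)
    replace ((s * r) ^ 2) with (sqrt (K / INR n) ^ 2 / L ^ 2)
      by (unfold s, r; field; lra).
    rewrite pow2_sqrt.
    + right. unfold e. field. lra.
    + apply Rmult_le_pos; [easy|now apply Rlt_le, Rinv_0_lt_compat].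
  - exists b, c. split; [|exact Hb]. split; nra.
Qed.

(** * Sums of residuals *)

Definition resid A n b c x j := spin x j - tanh (b * mloc A n x j + c).

(** A common shape for all four statistics to be controlled. When [G] has zero diagonal, the
    coefficient of the [j]-th residual does not depend on spin [j]. *)
Definition lin_stat A n b c (a : nat -> R) (G : nat -> nat -> R) x :=
  rsum n (fun j => (a j + rsum n (fun k => G j k * spin x k)) *
                   resid A n b c x j).

(** The conditional odds of spin [+1] against [-1], when [u] is the field acting on that spin. *)
Lemma exp_tanh u : exp (2 * u) * (1 - tanh u) = 1 + tanh u.
Proof.
  pose proof (exp_pos u). pose proof (exp_pos (- u)).
  unfold tanh, sinh, cosh.
  replace (2 * u) with (u + u) by ring. rewrite exp_plus.
  replace (exp u * exp u) with (exp u / exp (- u))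
    by (rewrite exp_Ropp; field; lra).
  field. lra.
Qed.

Lemma mloc_flip A n i k x :
  (i < n)%nat -> length x = n ->
  mloc A n (flip i x) k = mloc A n x k - 2 * (A n k i * spin x i).
Proof. intros Hi Hx. now apply (rsum_spin_flip n i (A n k)). Qed.

Lemma quadratic_flip A n i x :
  admissible A -> (i < n)%nat -> length x = n ->
  rsum n (fun k => spin (flip i x) k * mloc A n (flip i x) k) =
  rsum n (fun k => spin x k * mloc A n x k) - 4 * (spin x i * mloc A n x i).
Proof.
  intros HA Hi Hx.
  assert (Hii : A n i i = 0) by (apply (HA n i i Hi Hi)).
  (* The flipped local fields act as fixed coefficients while the spins are unflipped; the fields
     are unflipped afterwards. *)
  rewrite (rsum_ext n _ (fun k => mloc A n (flip i x) k * spin (flip i x) k))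
    by (intros; ring).
  rewrite rsum_spin_flip, mloc_flip, Hii by easy.
  rewrite (rsum_ext n (fun k => mloc A n (flip i x) k * spin x k)
    (fun k => spin x k * mloc A n x k - 2 * spin x i * (A n i k * spin x k))).
  - rewrite rsum_minus, rsum_scal. fold (mloc A n x i). ring.
  - intros k Hk. rewrite mloc_flip by easy.
    replace (A n k i) with (A n i k) by (apply (HA n i k Hi Hk)). ring.
Qed.

(** The residual has conditional mean zero, stated without conditioning. The zero diagonal leaves
    [u] fixed under the flip, the weights have ratio [exp (2 * (spin x i * u))], and [exp_tanh]
    concludes for either sign. *)
Lemma weight_resid_flip A n b c i x :
  admissible A -> (i < n)%nat -> length x = n ->
  ising_weight A n b c (flip i x) * resid A n b c (flip i x) i =
  - (ising_weight A n b c x * resid A n b c x i).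
Proof.
  intros HA Hi Hx.
  assert (Hii : A n i i = 0) by (apply (HA n i i Hi Hi)).
  unfold resid. rewrite mloc_flip, Hii, spin_flip_eq by (easy || lia).
  replace (mloc A n x i - 2 * (0 * spin x i)) with (mloc A n x i) by ring.
  set (u := b * mloc A n x i + c).
  assert (E : ising_weight A n b c x =
    ising_weight A n b c (flip i x) * exp (2 * (spin x i * u))).
  { unfold ising_weight. rewrite <- exp_plus. f_equal.
    rewrite quadratic_flip by easy.
    rewrite (rsum_ext n (fun k => spin (flip i x) k) (fun k => 1 * spin (flip i x) k))
      by (intros; ring).
    rewrite (rsum_spin_flip n i (fun _ => 1)) by easy.
    rewrite (rsum_ext n (fun k => 1 * spin x k) (fun k => spin x k))
      by (intros; ring).
    unfold u. field. }
  rewrite E.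
  enough (exp (2 * (spin x i * u)) * (spin x i - tanh u) = spin x i + tanh u)
    as H by (rewrite Rmult_assoc, H; ring).
  unfold spin. destruct (nth i x false).
  - rewrite Rmult_1_l. apply exp_tanh.
  - pose proof (exp_tanh (- u)) as H. rewrite tanh_opp in H.
    replace (2 * (-1 * u)) with (2 * - u) by ring. lra.
Qed.

Lemma resid_abs A n b c x j : Rabs (resid A n b c x j) <= 2.
Proof.
  unfold resid. pose proof (spin_abs x j).
  pose proof (tanh_abs_le_1 (b * mloc A n x j + c)) as H1.
  apply Rabs_le_between in H1. unfold Rabs in *.
  destruct (Rcase_abs (spin x j)); destruct Rcase_abs; lra.
Qed.

Lemma weight_pos A n b c x : 0 < ising_weight A n b c x.
Proof. apply exp_pos. Qed.

Lemma Zpart_pos A n b c : 0 < Zpart A n b c.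
Proof.
  (* The weight is made arbitrary because it depends on [n] through [A n], which would block the
     induction. *)
  unfold Zpart. generalize (weight_pos A n b c).
  generalize (ising_weight A n b c). induction n as [|n IH]; simpl; intros w Hw.
  - specialize (Hw []). lra.
  - rewrite lsum_app, !lsum_map.
    pose proof (IH _ (fun y => Hw (true :: y))).
    pose proof (IH _ (fun y => Hw (false :: y))). lra.
Qed.

(* Flipping spin [i] turns the weight times the [i]-th residual into its
   opposite, so each residual only sees half the increment of [H]. *)
Lemma resid_sum_second_moment A n b c g G L :
  admissible A -> 0 <= G ->
  let H x := rsum n (fun i => g i x * resid A n b c x i) in
  (forall i x, (i < n)%nat -> length x = n -> g i (flip i x) = g i x) ->
  (forall i x, (i < n)%nat -> length x = n -> Rabs (g i x) <= G) ->
  (forall i x, (i < n)%nat -> length x = n ->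
     Rabs (H x - H (flip i x)) <= L) ->
  lsum (configs n) (fun x => H x ^ 2 * ising_weight A n b c x) <=
  INR n * (G * L) * Zpart A n b c.
Proof.
  intros HA HG H Hg HgG HL.
  set (w := ising_weight A n b c).
  set (T i x := g i x * resid A n b c x i * w x).
  rewrite (lsum_ext _ _ (fun x => rsum n (fun i => T i x * H x))).
  2: { intros x _. unfold H at 1. unfold T.
    rewrite (rsum_ext n (fun i => g i x * resid A n b c x i * w x * H x)
      (fun i => (w x * H x) * (g i x * resid A n b c x i))) by (intros; ring).
    rewrite rsum_scal. fold (H x). ring. }
  rewrite lsum_rsum, Rmult_assoc. apply rsum_bound. intros i Hi.
  assert (E : lsum (configs n) (fun x => T i x * H x) =
    - lsum (configs n) (fun x => T i x * H (flip i x))).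
  { rewrite <- (lsum_configs_flip n i _ Hi).
    rewrite <- (Rmult_1_l (lsum (configs n) (fun x => T i x * H (flip i x)))).
    rewrite Ropp_mult_distr_l, <- lsum_scal.
    apply lsum_ext. intros x Hx. apply configs_length in Hx.
    unfold T. rewrite Hg by easy.
    pose proof (weight_resid_flip A n b c i x HA Hi Hx) as Hf. fold w in Hf.
    replace (g i x * resid A n b c (flip i x) i * w (flip i x) * H (flip i x))
      with (g i x * H (flip i x) * (w (flip i x) * resid A n b c (flip i x) i))
      by ring.
    rewrite Hf. ring. }
  (* By [E] the left side is twice the sum to be bounded; the 2 on the right is the bound on a
     residual. *)
  enough (lsum (configs n) (fun x => T i x * H x) -
          lsum (configs n) (fun x => T i x * H (flip i x)) <=
          2 * (G * L) * Zpart A n b c) by lra.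
  unfold Zpart. fold w. rewrite <- lsum_scal.
  replace (lsum (configs n) (fun x => T i x * H x) -
    lsum (configs n) (fun x => T i x * H (flip i x)))
    with (lsum (configs n) (fun x => T i x * (H x - H (flip i x)))).
  2: { rewrite (lsum_ext _ (fun x => T i x * (H x - H (flip i x)))
      (fun x => T i x * H x + -1 * (T i x * H (flip i x)))) by (intros; ring).
    rewrite lsum_plus, lsum_scal. ring. }
  apply lsum_le. intros x Hx. apply configs_length in Hx.
  unfold T.
  replace (g i x * resid A n b c x i * w x * (H x - H (flip i x))) with
    (g i x * resid A n b c x i * (H x - H (flip i x)) * w x) by ring.
  apply Rmult_le_compat_r; [apply Rlt_le, weight_pos|].
  eapply Rle_trans; [apply Rle_abs|]. rewrite !Rabs_mult.
  replace (2 * (G * L)) with (G * 2 * L) by ring.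
  apply Rmult_le_compat; [|apply Rabs_pos| |now apply HL].
  { apply Rmult_le_pos; apply Rabs_pos. }
  apply Rmult_le_compat; [apply Rabs_pos|apply Rabs_pos|now apply HgG|].
  apply resid_abs.
Qed.

(** The first term is the jump of the spin itself; the second is the change [2 A_ji] of the local
    field, passed through the 1-Lipschitz [tanh]. *)
Lemma resid_flip A n b c i j x :
  admissible A -> (i < n)%nat -> (j < n)%nat -> length x = n ->
  Rabs (resid A n b c x j - resid A n b c (flip i x) j) <=
  (if Nat.eqb j i then 2 else 0) + 2 * Rabs b * A n j i.
Proof.
  intros HA Hi Hj Hx. unfold resid. rewrite mloc_flip by easy.
  assert (HA' : 0 <= A n j i) by (apply (HA n j i Hj Hi)).
  assert (Ht := tanh_lipschitz
    (b * (mloc A n x j - 2 * (A n j i * spin x i)) + c) (b * mloc A n x j + c)).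
  replace (b * (mloc A n x j - 2 * (A n j i * spin x i)) + c -
    (b * mloc A n x j + c)) with (b * (-2) * A n j i * spin x i) in Ht by ring.
  rewrite !Rabs_mult, spin_abs, (Rabs_right (A n j i)) in Ht by lra.
  replace (Rabs (-2)) with 2 in Ht
    by (unfold Rabs; destruct Rcase_abs; lra).
  match type of Ht with Rabs (?u - ?v) <= _ =>
    set (t' := u) in *; set (t := v) in * end.
  replace (spin x j - t - (spin (flip i x) j - t')) with
    ((spin x j - spin (flip i x) j) + (t' - t)) by ring.
  eapply Rle_trans; [apply Rabs_triang|].
  apply Rplus_le_compat; [|lra].
  destruct (Nat.eqb_spec j i) as [->|Hji].
  - rewrite spin_flip_eq by lia.
    replace (spin x i - - spin x i) with (2 * spin x i) by ring.
    rewrite Rabs_mult, spin_abs, Rabs_right; lra.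
  - rewrite spin_flip_neq by easy. unfold Rminus. rewrite Rplus_opp_r, Rabs_R0. lra.
Qed.

(** Coefficients are at most [2 M]. A flip of spin [i] moves them by [2 |G_ji|] and the residuals as
    in [resid_flip], so column sums of [G] and row sums of [A] bound the increment by
    [4 M + 2 M (2 + 2 |b| gamma)]. *)
Lemma lin_stat_second_moment A n b c gamma a G M :
  admissible A ->
  (forall i, (i < n)%nat -> rsum n (fun j => A n i j) <= gamma) ->
  0 <= M ->
  (forall j, (j < n)%nat -> Rabs (a j) <= M) ->
  (forall j, (j < n)%nat -> G j j = 0) ->
  (forall j, (j < n)%nat -> rsum n (fun k => Rabs (G j k)) <= M) ->
  (forall k, (k < n)%nat -> rsum n (fun j => Rabs (G j k)) <= M) ->
  lsum (configs n)
    (fun x => lin_stat A n b c a G x ^ 2 * ising_weight A n b c x) <=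
  INR n * (2 * M * (4 * M * (2 + Rabs b * gamma))) * Zpart A n b c.
Proof.
  intros HA Hgamma HM Ha HG Hrow Hcol.
  set (g j x := a j + rsum n (fun k => G j k * spin x k)).
  assert (Hgf : forall i j x, (i < n)%nat -> length x = n ->
    g j (flip i x) = g j x - 2 * (G j i * spin x i)).
  { intros i j x Hi Hx. unfold g. rewrite rsum_spin_flip by easy. ring. }
  assert (HgM : forall j x, (j < n)%nat -> Rabs (g j x) <= 2 * M).
  { intros j x Hj. unfold g. eapply Rle_trans; [apply Rabs_triang|].
    replace (2 * M) with (M + M) by ring.
    apply Rplus_le_compat; [now apply Ha|].
    eapply Rle_trans; [apply rsum_abs|].
    rewrite (rsum_ext n _ (fun k => Rabs (G j k))); [now apply Hrow|].
    intros k _. rewrite Rabs_mult, spin_abs. ring. }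
  apply (resid_sum_second_moment A n b c g); [easy|lra| | |].
  - intros i x Hi Hx. rewrite Hgf, HG by easy. ring.
  - auto.
  - intros i x Hi Hx. rewrite <- rsum_minus.
    eapply Rle_trans; [apply rsum_abs|].
    apply Rle_trans with (rsum n (fun j => 4 * Rabs (G j i) +
      2 * M * ((if Nat.eqb j i then 2 else 0) + 2 * Rabs b * A n i j))).
    + apply rsum_le. intros j Hj.
      replace (g j x * resid A n b c x j - g j (flip i x) * resid A n b c (flip i x) j)
        with ((g j x - g j (flip i x)) * resid A n b c x j +
          g j (flip i x) * (resid A n b c x j - resid A n b c (flip i x) j))
        by ring.
      eapply Rle_trans; [apply Rabs_triang|]. rewrite !Rabs_mult.
      apply Rplus_le_compat.
      * rewrite Hgf by easy.
        replace (g j x - (g j x - 2 * (G j i * spin x i))) with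
          (2 * G j i * spin x i) by ring.
        rewrite !Rabs_mult, spin_abs, (Rabs_right 2) by lra.
        pose proof (resid_abs A n b c x j). pose proof (Rabs_pos (G j i)). nra.
      * apply Rmult_le_compat; [apply Rabs_pos|apply Rabs_pos|auto|].
        replace (A n i j) with (A n j i) by (apply (HA n j i Hj Hi)).
        now apply resid_flip.
    + rewrite rsum_plus, !rsum_scal, rsum_plus, rsum_scal, rsum_single by easy.
      specialize (Hcol i Hi). specialize (Hgamma i Hi).
      apply (Rmult_le_compat_l (2 * M * (2 * Rabs b))) in Hgamma.
      2: { pose proof (Rabs_pos b). apply Rmult_le_pos; lra. }
      change (fun j : nat => A n i j) with (A n i) in Hgamma. lra.
Qed.

(** * Fluctuation of the local fields *)

(* The off-diagonal part of [A_n^2] when [A_n] is symmetric. *)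
Definition offdiag_gram (A : Coupling) n j k :=
  if Nat.eqb j k then 0 else rsum n (fun i => A n i j * A n i k).

Lemma mloc_abs_le A n gamma x i :
  admissible A -> rsum n (fun j => A n i j) <= gamma -> (i < n)%nat ->
  Rabs (mloc A n x i) <= gamma.
Proof.
  intros HA Hg Hi. unfold mloc. eapply Rle_trans; [apply rsum_abs|].
  eapply Rle_trans; [|exact Hg]. apply rsum_le. intros j Hj.
  destruct (HA n i j Hi Hj) as (_ & H & _).
  rewrite Rabs_mult, spin_abs, Rabs_right; lra.
Qed.

(** Exchanging sums puts [(A^2 x)_j] in front of the [j]-th residual. Its diagonal part contains
    [x_j], so it is separated: it supplies the positive drift, while the other two terms are
    fluctuations. *)
Lemma local_field_pairing A n b c a x :
  admissible A ->
  rsum n (fun i => (mloc A n x i - a) *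
                   rsum n (fun j => A n i j * resid A n b c x j)) =
  lin_stat A n b c (fun _ => 0) (offdiag_gram A n) x
  + rsum n (fun j => rsum n (fun i => A n i j ^ 2) *
                     (spin x j * resid A n b c x j))
  - a * lin_stat A n b c (fun j => rsum n (fun k => A n j k))
          (fun _ _ => 0) x.
Proof.
  intros HA. set (e := resid A n b c x).
  rewrite (rsum_ext n _ (fun i => rsum n (fun j =>
    A n i j * mloc A n x i * e j) - a * rsum n (fun j => A n i j * e j))).
  2: { intros i _. rewrite Rmult_minus_distr_r, <- rsum_scal. f_equal.
       apply rsum_ext. intros; ring. }
  rewrite rsum_minus, rsum_scal.
  rewrite (rsum_swap n n (fun i j => A n i j * mloc A n x i * e j)).
  rewrite (rsum_swap n n (fun i j => A n i j * e j)). f_equal.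
  - unfold lin_stat. fold e. rewrite <- rsum_plus. apply rsum_ext. intros j Hj.
    rewrite (rsum_ext n _ (fun i => e j * (A n i j * mloc A n x i)))
      by (intros; ring).
    rewrite rsum_scal.
    enough (rsum n (fun i => A n i j * mloc A n x i) =
      rsum n (fun k => offdiag_gram A n j k * spin x k) +
      rsum n (fun i => A n i j ^ 2) * spin x j) as -> by ring.
    transitivity (rsum n (fun k => rsum n (fun i => A n i j * A n i k) * spin x k)).
    + rewrite (rsum_ext n _ (fun i => rsum n (fun k =>
        A n i j * A n i k * spin x k))).
      2: { intros i _. unfold mloc. rewrite <- rsum_scal.
           apply rsum_ext. intros; ring. }
      rewrite rsum_swap. apply rsum_ext. intros k _.
      rewrite (Rmult_comm _ (spin x k)), <- rsum_scal.
      apply rsum_ext. intros; ring.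
    (* The Gram row and its off-diagonal version differ only at [k = j]. *)
    + rewrite (rsum_update n j _ (fun k => offdiag_gram A n j k * spin x k) Hj).
      * unfold offdiag_gram. rewrite Nat.eqb_refl.
        rewrite (rsum_ext n (fun i => A n i j * A n i j) (fun i => A n i j ^ 2))
          by (intros; ring). ring.
      * intros k _ Hk. unfold offdiag_gram.
        destruct (Nat.eqb_spec j k); [congruence|reflexivity].
  - unfold lin_stat. fold e. f_equal. apply rsum_ext. intros j Hj.
    rewrite (rsum_ext n (fun k => 0 * spin x k) (fun _ => 0)) by (intros; ring).
    rewrite rsum_const.
    rewrite (rsum_ext n _ (fun i => e j * A n j i)).
    + rewrite rsum_scal. change (fun k : nat => A n j k) with (A n j). ring.
    + intros i Hi. replace (A n i j) with (A n j i) by (apply (HA n j i Hj Hi)).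
      ring.
Qed.

(** The drift is at least [n k c1] and the fluctuations cost at most [n eps (1 + gamma)], so at
    least [n k c1 / 2] remains in the pairing. Bounded [z i] then forces the [m_i - a] to be large
    in mean square. *)
Lemma local_field_variance_lower A n b c gamma c1 eps a x :
  let k := exp (- (2 * (Rabs b * gamma + Rabs c))) in
  admissible A -> 1 <= gamma ->
  (forall i, (i < n)%nat -> rsum n (fun j => A n i j) <= gamma) ->
  0 < c1 ->
  INR n * c1 <= rsum n (fun i => rsum n (fun j => A n i j ^ 2)) ->
  Rabs a <= gamma ->
  eps * (1 + gamma) <= k * c1 / 2 ->
  Rabs (lin_stat A n b c (fun _ => 0) (offdiag_gram A n) x) <= INR n * eps ->
  Rabs (lin_stat A n b c (fun j => rsum n (fun k => A n j k))
          (fun _ _ => 0) x) <= INR n * eps ->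
  INR n * ((k * c1) ^ 2 / (16 * gamma ^ 2)) <=
  rsum n (fun i => (mloc A n x i - a) ^ 2).
Proof.
  intros k HA Hg Hrow Hc1 Htr Ha Heps HW HR.
  assert (Hk : 0 < k) by apply exp_pos.
  pose proof (local_field_pairing A n b c a x HA) as E.
  set (W := lin_stat A n b c (fun _ => 0) _ x) in *.
  set (R' := lin_stat A n b c (fun j => rsum n (fun k => A n j k)) _ x) in *.
  set (z i := rsum n (fun j => A n i j * resid A n b c x j)) in *.
  assert (Hz : forall i, (i < n)%nat -> Rabs (z i) <= 2 * gamma).
  { intros i Hi. unfold z. eapply Rle_trans; [apply rsum_abs|].
    apply Rle_trans with (rsum n (fun j => 2 * A n i j)).
    - apply rsum_le. intros j Hj. destruct (HA n i j Hi Hj) as (_ & H & _).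
      rewrite Rabs_mult, (Rabs_right (A n i j)) by lra.
      pose proof (resid_abs A n b c x j). nra.
    - rewrite rsum_scal. specialize (Hrow i Hi).
      change (fun j : nat => A n i j) with (A n i) in Hrow. lra. }
  (* Here [x_j e_j = 1 - tanh (x_j u)], because [tanh] is odd, and this is at least [k]. *)
  assert (Hdiag : k * (INR n * c1) <= rsum n (fun j =>
    rsum n (fun i => A n i j ^ 2) * (spin x j * resid A n b c x j))).
  { apply Rle_trans with (rsum n (fun j => k * rsum n (fun i => A n i j ^ 2))).
    - rewrite rsum_scal, rsum_swap. apply Rmult_le_compat_l; lra.
    - apply rsum_le. intros j Hj. rewrite Rmult_comm.
      apply Rmult_le_compat_l; [apply rsum_nonneg; intros; apply pow2_ge_0|].
      unfold resid.
      pose proof (linear_abs_le b c (mloc A n x j) gamma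
        (mloc_abs_le A n gamma x j HA (Hrow j Hj) Hj)) as Hu.
      set (u := b * mloc A n x j + c) in *.
      rewrite Rmult_minus_distr_l, spin_sqr.
      unfold spin. destruct (nth j x false).
      + rewrite Rmult_1_l. now apply one_minus_tanh_lower.
      + replace (-1 * tanh u) with (tanh (- u)) by (rewrite tanh_opp; ring).
        apply one_minus_tanh_lower. now rewrite Rabs_Ropp. }
  assert (HaR : a * R' <= gamma * (INR n * eps)).
  { eapply Rle_trans; [apply Rle_abs|]. rewrite Rabs_mult.
    apply Rmult_le_compat; auto using Rabs_pos. }
  apply Rabs_le_between in HW.
  pose proof (pos_INR n) as Hn.
  assert (Hlow : INR n * (k * c1 / 2) <= rsum n (fun i => (mloc A n x i - a) * z i)).
  { apply (Rmult_le_compat_l _ _ _ Hn) in Heps. unfold z. rewrite E. lra. }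
  (* Chosen so that [t z_i^2 / 2 <= k c1 / 4], half of the lower bound on the pairing per site. *)
  set (t := k * c1 / (8 * gamma ^ 2)).
  assert (Hg2 : 0 < gamma ^ 2) by (apply pow_lt; lra).
  assert (Hkc : 0 < k * c1) by now apply Rmult_lt_0_compat.
  assert (Ht : 0 < t) by (apply Rdiv_lt_0_compat; lra).
  assert (Hup : rsum n (fun i => t * ((mloc A n x i - a) * z i)) <=
    rsum n (fun i => / 2 * (mloc A n x i - a) ^ 2 + t * (k * c1 / 4))).
  { apply rsum_le. intros i Hi. specialize (Hz i Hi).
    assert (Hz2 : z i ^ 2 <= 4 * gamma ^ 2).
    { rewrite <- pow2_abs. replace (4 * gamma ^ 2) with ((2 * gamma) ^ 2) by ring.
      apply pow_incr. split; [apply Rabs_pos|easy]. }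
    assert (Htz : t * (t * z i ^ 2) <= t * (k * c1 / 2)).
    { replace (k * c1 / 2) with (t * (4 * gamma ^ 2)) by (unfold t; field; lra).
      apply Rmult_le_compat_l; [lra|]. apply Rmult_le_compat_l; lra. }
    (* AM-GM: [(m_i - a) t z_i <= (m_i - a)^2 / 2 + t^2 z_i^2 / 2] *)
    pose proof (pow2_ge_0 (mloc A n x i - a - t * z i)). nra. }
  rewrite rsum_scal, rsum_plus, rsum_scal, rsum_const in Hup.
  apply (Rmult_le_compat_l t) in Hlow; [|lra].
  replace ((k * c1) ^ 2 / (16 * gamma ^ 2)) with (t * (k * c1) / 2)
    by (unfold t; field; lra).
  lra.
Qed.

(** * Proof of the theorem *)

Lemma indic_true P : P -> indic P = 1.
Proof. intros H. unfold indic. now destruct excluded_middle_informative. Qed.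

Lemma indic_false P : ~ P -> indic P = 0.
Proof. intros H. unfold indic. now destruct excluded_middle_informative. Qed.

Lemma ising_prob_markov A n b c (F : list bool -> R) M t (P : list bool -> Prop) :
  (forall x, 0 <= F x) -> 0 < t ->
  lsum (configs n) (fun x => F x * ising_weight A n b c x) <=
  M * Zpart A n b c ->
  (forall x, length x = n -> P x -> t < F x) ->
  ising_prob A n b c P <= M / t.
Proof.
  intros F_nonneg t_pos F_mean HP. unfold ising_prob. pose proof (Zpart_pos A n b c) as HZ.
  apply Rle_div_l; [easy|].
  apply Rmult_le_reg_l with t; [easy|].
  replace (t * (M / t * Zpart A n b c)) with (M * Zpart A n b c) by (field; lra).
  eapply Rle_trans; [|exact F_mean].
  rewrite <- lsum_scal. apply lsum_le. intros x Hx.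
  apply configs_length in Hx. rewrite <- Rmult_assoc.
  apply Rmult_le_compat_r; [apply Rlt_le, weight_pos|].
  destruct (excluded_middle_informative (P x)) as [H|H].
  - rewrite indic_true by easy. specialize (HP x Hx H). lra.
  - rewrite indic_false by easy. specialize (F_nonneg x). lra.
Qed.

Lemma ising_prob_compl A n b c P :
  ising_prob A n b c (fun x => ~ P x) = 1 - ising_prob A n b c P.
Proof.
  unfold ising_prob. pose proof (Zpart_pos A n b c) as HZ.
  enough (E : lsum (configs n) (fun x => indic (~ P x) * ising_weight A n b c x)
    = Zpart A n b c -
      lsum (configs n) (fun x => indic (P x) * ising_weight A n b c x))
    by (rewrite E; field; lra).
  set (w := ising_weight A n b c).
  enough (lsum (configs n) (fun x => indic (~ P x) * w x) +
          lsum (configs n) (fun x => indic (P x) * w x) = Zpart A n b c) by lra.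
  rewrite <- lsum_plus. apply lsum_ext. intros x _.
  destruct (excluded_middle_informative (P x)) as [H|H].
  - rewrite (indic_true (P x)), (indic_false (~ P x)) by tauto. fold w; ring.
  - rewrite (indic_false (P x)), (indic_true (~ P x)) by tauto. fold w; ring.
Qed.

(** The squares of the two scores and of the two fluctuation terms of [local_field_pairing]; adding
    them lets a single Markov bound control all four. *)
Definition stat_total (A : Coupling) n b c x :=
  lin_stat A n b c (fun _ => 0) (A n) x ^ 2 +
  lin_stat A n b c (fun _ => 1) (fun _ _ => 0) x ^ 2 +
  lin_stat A n b c (fun _ => 0) (offdiag_gram A n) x ^ 2 +
  lin_stat A n b c (fun j => rsum n (fun k => A n j k)) (fun _ _ => 0) x ^ 2.

Lemma stat_total_nonneg A n b c x : 0 <= stat_total A n b c x.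
Proof.
  unfold stat_total.
  repeat (apply Rplus_le_le_0_compat || apply pow2_ge_0).
Qed.

(** Entries of [A^2] are non-negative, and its row sums are those of [A] applied twice. *)
Lemma offdiag_gram_rsum_abs A n gamma j :
  admissible A -> 0 <= gamma ->
  (forall i, (i < n)%nat -> rsum n (fun j => A n i j) <= gamma) ->
  (j < n)%nat -> rsum n (fun k => Rabs (offdiag_gram A n j k)) <= gamma ^ 2.
Proof.
  intros HA Hg Hrow Hj.
  apply Rle_trans with (rsum n (fun k => rsum n (fun i => A n i j * A n i k))).
  - apply rsum_le. intros k Hk.
    assert (H0 : 0 <= rsum n (fun i => A n i j * A n i k)).
    { apply rsum_nonneg. intros i Hi. apply Rmult_le_pos; now apply HA. }
    unfold offdiag_gram. destruct (Nat.eqb j k).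
    + now rewrite Rabs_R0.
    + rewrite Rabs_right; lra.
  - rewrite rsum_swap. apply Rle_trans with (rsum n (fun i => gamma * A n j i)).
    + apply rsum_le. intros i Hi. rewrite rsum_scal.
      destruct (HA n i j Hi Hj) as (E & H & _). rewrite <- E.
      rewrite Rmult_comm. now apply Rmult_le_compat_r; [|apply Hrow].
    + rewrite rsum_scal. simpl. rewrite Rmult_1_r.
      apply Rmult_le_compat_l; [easy|now apply Hrow].
Qed.

(** [M = gamma^2] serves all four statistics because [1 <= gamma]; four times [2 M * 4 M] gives the
    factor [32 gamma^4]. *)
Lemma stat_total_mean A n b c gamma :
  admissible A -> 1 <= gamma ->
  (forall i, (i < n)%nat -> rsum n (fun j => A n i j) <= gamma) ->
  lsum (configs n) (fun x => stat_total A n b c x * ising_weight A n b c x) <=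
  INR n * (32 * gamma ^ 4 * (2 + Rabs b * gamma)) * Zpart A n b c.
Proof.
  intros HA Hg Hrow.
  set (w := ising_weight A n b c).
  assert (Hg1 : 1 <= gamma ^ 2) by nra.
  assert (Hg2 : gamma <= gamma ^ 2) by nra.
  assert (Hpos : forall i j, (i < n)%nat -> (j < n)%nat -> 0 <= A n i j)
    by (intros; now apply HA).
  assert (Hsym : forall i j, (i < n)%nat -> (j < n)%nat -> A n i j = A n j i)
    by (intros; now apply HA).
  assert (Habs : forall i, (i < n)%nat ->
    rsum n (fun j => Rabs (A n i j)) <= gamma ^ 2).
  { intros i Hi. rewrite (rsum_ext n _ (fun j => A n i j)).
    - specialize (Hrow i Hi). lra.
    - intros j Hj. apply Rabs_right, Rle_ge. auto. }
  assert (H0 : rsum n (fun _ => Rabs 0) <= gamma ^ 2).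
  { rewrite Rabs_R0, rsum_const. lra. }
  assert (H00 : Rabs 0 <= gamma ^ 2) by (rewrite Rabs_R0; lra).
  assert (Hd : forall j, (j < n)%nat ->
    Rabs (rsum n (fun k => A n j k)) <= gamma ^ 2).
  { intros j Hj. eapply Rle_trans; [apply rsum_abs|auto]. }
  pose proof (lin_stat_second_moment A n b c gamma (fun _ => 0) (A n)
    (gamma ^ 2) HA Hrow) as M1.
  pose proof (lin_stat_second_moment A n b c gamma (fun _ => 1) (fun _ _ => 0)
    (gamma ^ 2) HA Hrow) as M2.
  pose proof (lin_stat_second_moment A n b c gamma (fun _ => 0)
    (offdiag_gram A n) (gamma ^ 2) HA Hrow) as M3.
  pose proof (lin_stat_second_moment A n b c gamma
    (fun j => rsum n (fun k => A n j k)) (fun _ _ => 0)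
    (gamma ^ 2) HA Hrow) as M4.
  assert (Hc : 0 <= gamma ^ 2) by lra.
  assert (HcolA : forall k, (k < n)%nat ->
    rsum n (fun j => Rabs (A n j k)) <= gamma ^ 2).
  { intros k Hk. rewrite (rsum_ext n _ (fun j => Rabs (A n k j))); auto.
    intros j Hj. now rewrite Hsym. }
  assert (HcolG : forall k, (k < n)%nat ->
    rsum n (fun j => Rabs (offdiag_gram A n j k)) <= gamma ^ 2).
  { intros k Hk.
    rewrite (rsum_ext n _ (fun j => Rabs (offdiag_gram A n k j))).
    - apply offdiag_gram_rsum_abs; auto. lra.
    - intros j Hj. unfold offdiag_gram. rewrite Nat.eqb_sym.
      destruct (Nat.eqb k j); [easy|]. f_equal. apply rsum_ext. intros; ring. }
  specialize (M1 Hc (fun _ _ => H00) (fun j Hj => proj2 (proj2 (HA n j j Hj Hj)))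
                Habs HcolA).
  specialize (M2 Hc ltac:(intros; cbv beta; rewrite Rabs_R1; lra) (fun _ _ => eq_refl)
                (fun _ _ => H0) (fun _ _ => H0)).
  specialize (M3 Hc (fun _ _ => H00)
    ltac:(intros; unfold offdiag_gram; now rewrite Nat.eqb_refl)
    ltac:(intros; apply offdiag_gram_rsum_abs; auto; lra) HcolG).
  specialize (M4 Hc Hd (fun _ _ => eq_refl) (fun _ _ => H0) (fun _ _ => H0)).
  fold w in M1, M2, M3, M4.
  unfold stat_total.
  rewrite (lsum_ext _ _ (fun x =>
    lin_stat A n b c (fun _ => 0) (A n) x ^ 2 * w x +
    (lin_stat A n b c (fun _ => 1) (fun _ _ => 0) x ^ 2 * w x +
    (lin_stat A n b c (fun _ => 0) (offdiag_gram A n) x ^ 2 * w x +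
     lin_stat A n b c (fun j => rsum n (fun k => A n j k)) (fun _ _ => 0) x ^ 2
       * w x)))) by (intros; ring).
  rewrite !lsum_plus.
  replace (INR n * (32 * gamma ^ 4 * (2 + Rabs b * gamma)) * Zpart A n b c)
    with (4 * (INR n * (2 * gamma ^ 2 * (4 * gamma ^ 2 * (2 + Rabs b * gamma)))
          * Zpart A n b c)) by ring.
  lra.
Qed.

Lemma nat_above (r : R) : exists N, forall n, (N <= n)%nat -> r < INR n.
Proof.
  destruct (INR_unbounded r) as [N HN]. exists N. intros n Hn.
  apply le_INR in Hn. lra.
Qed.

(** The deterministic half of the argument: probability enters only through the size of
    [stat_total]. [L] is chosen before [K], and only the threshold [N] depends on [K]. *)
Lemma MPLE_of_stat_total A b0 c0 :
  admissible A -> cond_C1 A -> nonsparse A ->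
  exists L, 0 < L /\ forall K, 0 < K -> exists N, forall n x, (N <= n)%nat ->
    stat_total A n b0 c0 x <= K * INR n ->
    exists b c, is_MPLE A n x b c /\
      INR n * ((b - b0) ^ 2 + (c - c0) ^ 2) <= L * K.
Proof.
  intros HA [gamma0 Hg0] (c1 & Hc1 & N1 & Htr).
  set (gamma := Rmax gamma0 1).
  assert (Hg : 1 <= gamma) by apply Rmax_r.
  assert (Hrow : forall n i, (i < n)%nat -> rsum n (fun j => A n i j) <= gamma).
  { intros n i Hi. eapply Rle_trans; [now apply Hg0|apply Rmax_l]. }
  set (k := exp (- (2 * (Rabs b0 * gamma + Rabs c0)))).
  assert (Hk : 0 < k) by apply exp_pos.
  assert (Hkc : 0 < k * c1) by now apply Rmult_lt_0_compat.
  set (eps := k * c1 / 2 / (1 + gamma)).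
  assert (Heps : 0 < eps)
    by (unfold eps; repeat apply Rdiv_lt_0_compat; lra).
  set (delta := (k * c1) ^ 2 / (16 * gamma ^ 2)).
  assert (Hg2 : 1 <= gamma ^ 2) by nra.
  assert (Hdelta : 0 < delta).
  { apply Rdiv_lt_0_compat; [now apply pow_lt|lra]. }
  set (lam := Rmin (/ 2) (delta / (1 + 2 * gamma ^ 2))).
  assert (Hlam : 0 < lam).
  { apply Rmin_glb_lt; [lra|]. apply Rdiv_lt_0_compat; lra. }
  assert (Hlam2 : lam <= / 2) by apply Rmin_l.
  assert (Hlam3 : lam * (1 + 2 * gamma ^ 2) <= delta).
  { apply Rle_div_r; [lra|apply Rmin_r]. }
  set (U := (Rabs b0 + 1) * gamma + Rabs c0 + 1).
  set (kl := exp (- (2 * U)) * lam).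
  assert (Hkl : 0 < kl) by (apply Rmult_lt_0_compat; [apply exp_pos|easy]).
  (* The squared radius in [score_root_exists] is [4 K / (n kl^2)]. *)
  exists (4 / kl ^ 2).
  split; [apply Rdiv_lt_0_compat; [lra|now apply pow_lt]|].
  intros K HK.
  (* Beyond [N2] the bound [sqrt (K n)] on each statistic is at most [n eps]; beyond [N3] the radius
     is at most 1. *)
  destruct (nat_above (K / eps ^ 2)) as [N2 HN2].
  destruct (nat_above (4 * K / kl ^ 2)) as [N3 HN3].
  exists (S (N1 + N2 + N3)). intros n x Hn HF.
  specialize (HN2 n ltac:(lia)). specialize (HN3 n ltac:(lia)).
  specialize (Htr n ltac:(lia)).
  assert (Hn0 : (0 < n)%nat) by lia.
  assert (Hn' : 0 < INR n) by now apply lt_0_INR.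
  assert (Hm : forall i, (i < n)%nat -> Rabs (mloc A n x i) <= gamma)
    by (intros; now apply mloc_abs_le; auto).
  assert (HKe : K * INR n <= (INR n * eps) ^ 2).
  { apply Rlt_div_l in HN2; [|now apply pow_lt]. nra. }
  assert (Habs : forall y, y ^ 2 <= stat_total A n b0 c0 x ->
    Rabs y <= INR n * eps).
  { intros y Hy. rewrite <- (Rabs_right (INR n * eps)).
    - apply Rsqr_le_abs_0. unfold Rsqr. lra.
    - apply Rle_ge, Rmult_le_pos; lra. }
  unfold stat_total in HF, Habs.
  set (S1 := lin_stat A n b0 c0 (fun _ => 0) (A n) x) in *.
  set (S2 := lin_stat A n b0 c0 (fun _ => 1) _ x) in *.
  set (W := lin_stat A n b0 c0 (fun _ => 0) (offdiag_gram A n) x) in *.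
  set (R' := lin_stat A n b0 c0 (fun j => rsum n (fun k => A n j k)) _ x) in *.
  pose proof (pow2_ge_0 S1). pose proof (pow2_ge_0 S2).
  pose proof (pow2_ge_0 W). pose proof (pow2_ge_0 R').
  set (a := rsum n (mloc A n x) / INR n).
  assert (Ha : INR n * a = rsum n (mloc A n x)) by (unfold a; field; lra).
  assert (Hag : Rabs a <= gamma).
  { apply Rmult_le_reg_l with (INR n); [easy|].
    rewrite <- (Rabs_right (INR n)) at 1 by lra.
    rewrite <- Rabs_mult, Ha. eapply Rle_trans; [apply rsum_abs|].
    now apply rsum_bound. }
  assert (Hvar : INR n * delta <= rsum n (fun i => (mloc A n x i - a) ^ 2)).
  { apply (local_field_variance_lower A n b0 c0 gamma c1 eps); auto.
    - apply (Rmult_le_compat_l (INR n)) in Htr; [|lra].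
      rewrite <- Rmult_assoc, Rinv_r, Rmult_1_l in Htr by lra. exact Htr.
    - fold k. right. unfold eps. field. lra.
    - apply Habs. fold W. lra.
    - apply Habs. fold R'. lra. }
  assert (Hquad : forall p q, INR n * (lam * (p ^ 2 + q ^ 2)) <=
    rsum n (fun i => (p * mloc A n x i + q) ^ 2)).
  { intros p q. apply (quadratic_form_lower n _ a gamma delta); auto; lra. }
  assert (E1 : S1 = score1 n (mloc A n x) (spin x) b0 c0).
  { apply rsum_ext. intros i _. unfold resid.
    change (rsum n (fun k0 => A n i k0 * spin x k0)) with (mloc A n x i). ring. }
  assert (E2 : S2 = score2 n (mloc A n x) (spin x) b0 c0).
  { apply rsum_ext. intros i _. unfold resid.
    rewrite (rsum_ext n _ (fun _ => 0)) by (intros; ring).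
    rewrite rsum_const. ring. }
  assert (Hr2 : (2 * sqrt (K / INR n) / kl) ^ 2 = 4 * K / kl ^ 2 / INR n).
  { unfold Rdiv. rewrite !Rpow_mult_distr, pow2_sqrt.
    - rewrite pow_inv. field. lra.
    - apply Rlt_le, Rdiv_lt_0_compat; lra. }
  destruct (score_root_exists n (mloc A n x) (spin x) gamma lam K b0 c0)
    as (b & c & Hroot & Hball); auto; try lra.
  - rewrite <- E1, <- E2. lra.
  - fold U. fold kl. apply Rsqr_incr_0_var; [|lra]. unfold Rsqr.
    apply Rle_trans with ((2 * sqrt (K / INR n) / kl) ^ 2); [right; ring|].
    rewrite Hr2. apply Rle_div_l; lra.
  - exists b, c. split; [split|].
    + exact Hroot.
    + intros b' c' Hroot'.
      apply (score_root_unique n (mloc A n x) (spin x) gamma lam); auto.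
    + fold U in Hball. fold kl in Hball. rewrite Hr2 in Hball.
      apply (Rmult_le_compat_l (INR n)) in Hball; [|lra].
      replace (INR n * (4 * K / kl ^ 2 / INR n)) with (4 / kl ^ 2 * K)
        in Hball by (field; lra).
      exact Hball.
Qed.

Theorem theorem5 (A : Coupling) (HA : admissible A) (HC1 : cond_C1 A)
    (Hsp : nonsparse A) (beta0 B0 : R) (Hbeta0 : 0 < beta0) (HB0 : B0 <> 0) :
  (* existence with probability tending to one *)
  (forall eps, 0 < eps -> exists N, forall n, (N <= n)%nat ->
      1 - eps <= ising_prob A n beta0 B0 (MPLE_exists A n))
  /\
  (* tightness of sqrt n ((beta_hat, B_hat) - (beta0, B0)) *)
  (forall eps, 0 < eps -> exists M N, forall n, (N <= n)%nat ->
      ising_prob A n beta0 B0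
        (fun x => exists b c, is_MPLE A n x b c /\
           sqrt (INR n) * sqrt ((b - beta0) ^ 2 + (c - B0) ^ 2) > M)
      <= eps).
Proof.
  destruct (MPLE_of_stat_total A beta0 B0 HA HC1 Hsp) as (L & HL & Hroot).
  destruct HC1 as [gamma0 Hg0].
  set (gamma := Rmax gamma0 1).
  assert (Hg : 1 <= gamma) by apply Rmax_r.
  assert (Hrow : forall n i, (i < n)%nat -> rsum n (fun j => A n i j) <= gamma).
  { intros n i Hi. eapply Rle_trans; [now apply Hg0|apply Rmax_l]. }
  set (C := 32 * gamma ^ 4 * (2 + Rabs beta0 * gamma)).
  assert (HC : 0 < C).
  { pose proof (Rabs_pos beta0). assert (0 < gamma ^ 4) by (apply pow_lt; lra).
    unfold C. apply Rmult_lt_0_compat; [lra|nra]. }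
  (* The threshold [C / eps * n] makes the Markov bound exactly [eps]. *)
  assert (Hmarkov : forall eps n P, 0 < eps -> (0 < n)%nat ->
    (forall x, P x -> C / eps * INR n < stat_total A n beta0 B0 x) ->
    ising_prob A n beta0 B0 P <= eps).
  { intros eps n P He Hn HP. apply lt_0_INR in Hn.
    replace eps with (INR n * C / (C / eps * INR n)) by (field; lra).
    apply (ising_prob_markov A n beta0 B0 (stat_total A n beta0 B0)).
    - apply stat_total_nonneg.
    - apply Rmult_lt_0_compat; [now apply Rdiv_lt_0_compat|easy].
    - now apply stat_total_mean; [| |apply Hrow].
    - auto. }
  split; intros eps He; destruct (Hroot (C / eps)) as [N HN];
    try now apply Rdiv_lt_0_compat.
  - exists (S N). intros n Hn.
    enough (ising_prob A n beta0 B0 (fun x => ~ MPLE_exists A n x) <= eps) as H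
      by (rewrite ising_prob_compl in H; lra).
    apply Hmarkov; [easy|lia|]. intros x Hx. apply Rnot_le_lt. intros HF.
    apply Hx. destruct (HN n x ltac:(lia) HF) as (b & c & H & _).
    now exists b, c.
  - exists (sqrt (L * (C / eps))), (S N). intros n Hn.
    apply Hmarkov; [easy|lia|]. intros x (b & c & Hbc & Hfar).
    apply Rnot_le_lt. intros HF.
    destruct (HN n x ltac:(lia) HF) as (b' & c' & [_ Huniq] & Hnear).
    (* Uniqueness identifies the given estimator with the root found near the true parameters. *)
    destruct (Huniq b c (proj1 Hbc)) as [-> ->].
    rewrite <- sqrt_mult_alt in Hfar by apply pos_INR.
    apply sqrt_le_1_alt in Hnear. lra.
Qed.
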